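(* Let $q_3=x_1^2+x_2^2+x_3^2\in\mathbb{C}[x_1,x_2,x_3]$. Then $\operatorname{rk}(q_3^4)=16$.
   Context: For a homogeneous polynomial $f\in\mathbb{C}[x_1,\dots,x_n]$ of degree $d$, the (complex) Waring rank $\operatorname{rk}(f)$ is the minimum $r\in\mathbb{N}$ such that $f=\sum_{j=1}^r\ell_j^d$ for some linear forms $\ell_1,\dots,\ell_r$ with complex coefficients. *)

(* Defs.v *)
From HB Require Import structures.
From mathcomp Require Import all_boot all_order all_algebra.
From mathcomp Require Export reals complex mpoly.

Set Implicit Arguments.
Unset Strict Implicit.
Unset Printing Implicit Defensive.

Import GRing.Theory.
Local Open Scope ring_scope.

(* [1.-homog] contains 0, so the linear forms are exactly the linear
   combinations of the variables. *)
Definition waring_decomposition (K : comNzRingType) (n d : nat)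
    (f : {mpoly K[n]}) (r : nat) (l : 'I_r -> {mpoly K[n]}) : Prop :=
  (forall j, l j \is 1.-homog) /\ f = \sum_(j < r) l j ^+ d.

(* [f] is meant to be a form of degree [d]; the degree is passed explicitly
   because it is not determined by [f] when [f = 0]. The rank is given by its
   graph, so that asserting a value includes the existence of the minimum. *)
Definition is_waring_rank (K : comNzRingType) (n d : nat)
    (f : {mpoly K[n]}) (r : nat) : Prop :=
  (exists l : 'I_r -> {mpoly K[n]}, waring_decomposition d f l) /\
  (forall (s : nat) (l : 'I_s -> {mpoly K[n]}),
     waring_decomposition d f l -> (r <= s)%N).

Definition sum_of_squares (K : comNzRingType) (n : nat) : {mpoly K[n]} :=
  \sum_(i < n) 'X_i ^+ 2.

(* Main.v *)
Require Import Defs.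
From mathcomp Require Import all_boot all_order all_algebra.
From mathcomp Require Import reals complex mpoly.
From mathcomp Require Import ring.

Set Implicit Arguments.
Unset Strict Implicit.
Unset Printing Implicit Defensive.

Import Order.TTheory GRing.Theory Num.Theory.
Local Open Scope ring_scope.

(** Write q for the sum of three squares, x . y for the bilinear dot product,
and l_k = z_k . y for the linear forms of a decomposition of q^4.

Sixteen powers suffice because of the icosahedron. Its 6 axes and the 10 axes
of the dual dodecahedron are permuted by the icosahedral group, whose
invariants of degree 8 are spanned by q^4 and q times an invariant of degree
6; one choice of relative weight removes the latter, and the weights are
absorbed into the forms by extracting 8th roots
([quartic_power_decomposition]).

Fewer than sixteen do not suffice because fifteen would be a tight design.
Applying the Laplacian to the identity sum_k (z_k . y)^8 = q(y)^4 gives all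
the moments sum_k q(z_k)^e (z_k . y)^(8 - 2e), and reading it along lines
y + t x gives mixed moments. These say that the points z_k integrate forms of
degree 8 as an invariant functional does, so the reproducing kernel K of
quartic forms for that functional satisfies
sum_k K(x, z_k) K(z_k, y) = K(x, y) ([zonal_kernel_reproducing]). Hence the
Gram matrix of the values K(z_i, z_j) is idempotent. Its trace is 15, the
dimension of the space of ternary quartics, so its rank is 15 and there are at
least 15 points.

With exactly 15 points the Gram matrix is the identity. Off the diagonal
K(z_i, z_j) = 0 is a quadratic equation for the squared cosine
u = (z_i . z_j)^2 / (q(z_i) q(z_j)), namely 21 u^2 - 14 u + 1 = 0, that is,
(21 u - 7)^2 = 28. For a fixed i the 14 numbers 21 u - 7 thus agree up to
sign, and the degree 2 moment makes their sum -14. So 14^2 = 28 n^2 for an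
integer n, and 7 would be a perfect square ([no_tight_decomposition]). *)

(** * Coefficients of powers of polynomials *)

Lemma horner_inj (F : numDomainType) (p q : {poly F}) :
  (forall t, p.[t] = q.[t]) -> p = q.
Proof.
move=> eq_pq; pose naturals : seq F := [seq i%:R | i <- iota 0 (size (p - q))].
apply/subr0_eq/(@roots_geq_poly_eq0 _ _ naturals).
- by apply/allP => t _; rewrite rootE hornerD hornerN eq_pq subrr.
- by rewrite map_inj_uniq ?iota_uniq // => i j /eqP; rewrite eqr_nat => /eqP.
- by rewrite size_map size_iota.
Qed.

Section PowerCoefficients.
Variable R : comNzRingType.
Implicit Type p : {poly R}.

Lemma coef0_exp p m : (p ^+ m)`_0 = p`_0 ^+ m.
Proof. by rewrite -!horner_coef0 horner_exp. Qed.

Lemma coef1_exp p m : (p ^+ m)`_1 = m%:R * (p`_0 ^+ m.-1 * p`_1).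
Proof.
elim: m => [|[|m] IHm]; rewrite ?expr0 ?coefC ?mul0r //= ?expr1 ?mul1r //.
rewrite exprS coefM !big_ord_recl big_ord0 /= /bump /= add1n IHm coef0_exp /=.
by rewrite !exprS; ring.
Qed.

Lemma coef2_exp p m : (p ^+ m)`_2 =
  m%:R * (p`_0 ^+ m.-1 * p`_2) + 'C(m, 2)%:R * (p`_0 ^+ m.-2 * p`_1 ^+ 2).
Proof.
elim: m => [|[|m] IHm]; first by rewrite expr0 coefC bin_small // !mul0r addr0.
  by rewrite expr1 bin_small //= !mul1r mul0r addr0.
rewrite exprS coefM !big_ord_recl big_ord0 /= /bump /= !add1n IHm.
rewrite coef0_exp coef1_exp /= (binS m.+1) bin1.
case: m {IHm} => [|m] /=; last by rewrite !exprS; ring.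
by rewrite (bin_small (ltnSn 1)); ring.
Qed.

Definition trinomial a b c : {poly R} := a%:P + b *: 'X + c *: 'X^2.

Lemma horner_trinomial a b c t :
  (trinomial a b c).[t] = a + b * t + c * t ^+ 2.
Proof. by rewrite !hornerE. Qed.

Lemma coef_trinomial a b c i : (trinomial a b c)`_i = [:: a; b; c]`_i.
Proof.
rewrite !coefE; case: i => [|[|[|i]]] /=; rewrite ?nth_nil; ring.
Qed.

Lemma coef4_trinomial_exp4 a b c : (trinomial a b c ^+ 4)`_4 =
  6%:R * (a * c) ^+ 2 + 12%:R * (a * c) * b ^+ 2 + b ^+ 4.
Proof.
rewrite (exprM _ 2 2) expr2 coefM !big_ord_recl big_ord0.
rewrite /= /bump /= ?add1n !expr2 !coefM !big_ord_recl !big_ord0 /= /bump /=.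
by rewrite !add1n !coef_trinomial /=; ring.
Qed.

End PowerCoefficients.

(** * Traces of idempotents *)

(** A full rank factorization A = C B turns A A = A into B C = 1, and
the trace of A = C B is that of B C. *)
Lemma mxtrace_idem (F : fieldType) n (A : 'M[F]_n) :
  A *m A = A -> \tr A = (\rank A)%:R.
Proof.
move=> idA; move: (mulmx_base A) (row_base_free A) (col_base_full A).
move: (col_base A) (row_base A) => C B CB_A freeB fullC.
rewrite -[in LHS]CB_A mxtrace_mulC -mxtrace1; congr mxtrace.
apply: (row_free_inj freeB); apply: (row_full_inj fullC).
by rewrite mul1mx !mulmxA CB_A -mulmxA CB_A.
Qed.

(** * Moments of zonal identities *)

(** Bilinear, also over the complex numbers: isotropic vectors exist. *)
Definition dot (R : pzSemiRingType) n (x y : 'I_n -> R) : R := \sum_i x i * y i.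

Lemma dotC (R : comPzSemiRingType) n (x y : 'I_n -> R) : dot x y = dot y x.
Proof. by apply: eq_bigr => i _; rewrite mulrC. Qed.

Lemma dotDZ (R : comPzRingType) n (u x y : 'I_n -> R) t :
  dot u (fun i => y i + t * x i) = dot u y + t * dot u x.
Proof.
by rewrite /dot mulr_sumr -big_split; apply: eq_bigr => i _ /=; ring.
Qed.

Section Moments.
Variables (F : numFieldType) (n s : nat) (z : 'I_s -> 'I_n -> F).
Implicit Types x y : 'I_n -> F.

(** Restricting a zonal identity to the line y + t x gives an identity between
polynomials in t, whose coefficients are the polarized identities. Squaring
the linear form makes both sides combinations of powers of trinomials. *)
Lemma line_identity (w : 'I_s -> F) c m :
    (forall y, \sum_k w k * dot (z k) y ^+ (2 * m) = c * dot y y ^+ m) ->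
  forall x y, \sum_k w k *: trinomial (dot (z k) y ^+ 2)
     (2%:R * dot (z k) y * dot (z k) x) (dot (z k) x ^+ 2) ^+ m =
  c *: trinomial (dot y y) (2%:R * dot x y) (dot x x) ^+ m.
Proof.
move=> zonal x y; apply: horner_inj => t; rewrite horner_sum hornerZ horner_exp.
rewrite horner_trinomial.
transitivity (c * dot (fun i => y i + t * x i) (fun i => y i + t * x i) ^+ m).
  rewrite -zonal; apply: eq_bigr => k _.
  rewrite hornerZ horner_exp horner_trinomial dotDZ exprM.
  by congr (_ * _ ^+ _); ring.
rewrite dotDZ (dotC _ x) (dotC _ y) !dotDZ (dotC y x).
by congr (_ * _ ^+ _); ring.
Qed.

(** The coefficient of t^2, divided by the common factor m + 1. *)
Lemma zonal_polar2 w c m :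
    (forall y, \sum_k w k * dot (z k) y ^+ (2 * m.+1) = c * dot y y ^+ m.+1) ->
  forall x y,
    (2 * m + 1)%:R * (\sum_k w k * dot (z k) x ^+ 2 * dot (z k) y ^+ (2 * m)) =
    c * (dot x x * dot y y ^+ m + (2 * m)%:R * dot x y ^+ 2 * dot y y ^+ m.-1).
Proof.
move=> /line_identity zonal x y.
have bin2 : 2%:R * 'C(m.+1, 2)%:R = m.+1%:R * m%:R :> F.
  by rewrite -!natrM -mul_bin_diag bin1.
have /(congr1 (coefp 2)) := zonal x y.
rewrite /= coef_sum coefZ coef2_exp !coef_trinomial /= => coef2.
apply: (@mulfI _ m.+1%:R); first by rewrite pnatr_eq0.
transitivity (c * (m.+1%:R * (dot y y ^+ m * dot x x) + 'C(m.+1, 2)%:R *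
   (dot y y ^+ m.-1 * (2%:R * dot x y) ^+ 2))); last first.
  transitivity (c * m.+1%:R * (dot y y ^+ m * dot x x) +
    (2%:R * 'C(m.+1, 2)%:R) * c * 2%:R * dot y y ^+ m.-1 * dot x y ^+ 2).
    by ring.
  by rewrite bin2; ring.
rewrite -coef2 !mulr_sumr; apply: eq_bigr => k _.
rewrite coefZ coef2_exp !coef_trinomial /=.
move: (dot _ x) (dot _ y) => a b.
(* For m = 0 the truncated predecessor in the exponent spoils the generic
   computation, but there the binomial coefficient vanishes. *)
case: m bin2 {zonal coef2} => [|m] bin2 /=.
  by rewrite bin_small // !muln0; ring.
transitivity (w k * (m.+2%:R * a ^+ 2 * b ^+ (2 * m.+1) +
   (2%:R * 'C(m.+2, 2)%:R) * 2%:R * a ^+ 2 * b ^+ (2 * m.+1))).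
  by rewrite bin2; ring.
by rewrite !(exprM b) !exprS; ring.
Qed.

(** The effect of the Laplacian in y, obtained by summing [zonal_polar2] over
the unit vectors x, so that no derivative is needed. *)
Lemma zonal_contraction w c m :
    (forall y, \sum_k w k * dot (z k) y ^+ (2 * m.+1) = c * dot y y ^+ m.+1) ->
  forall y,
    (2 * m + 1)%:R *
      (\sum_k w k * dot (z k) (z k) * dot (z k) y ^+ (2 * m)) =
    (n + 2 * m)%:R * c * dot y y ^+ m.
Proof.
move=> /zonal_polar2 polar y.
pose e (i j : 'I_n) : F := (j == i)%:R.
have dot_e u i : dot u (e i) = u i.
  rewrite /dot (bigD1 i) //= big1 /e => [|j /negPf->]; last by rewrite mulr0.
  by rewrite eqxx mulr1 addr0.
transitivity (\sum_i c * (dot (e i) (e i) * dot y y ^+ m +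
    (2 * m)%:R * dot (e i) y ^+ 2 * dot y y ^+ m.-1)).
  under [RHS]eq_bigr do rewrite -polar.
  rewrite -mulr_sumr exchange_big; congr (_ * _); apply: eq_bigr => k _.
  rewrite -mulr_suml -mulr_sumr; congr (_ * _ * _); apply: eq_bigr => i _.
  by rewrite dot_e expr2.
rewrite -mulr_sumr big_split /= -!mulr_suml -mulr_sumr.
under eq_bigr do rewrite dot_e /e eqxx.
under [X in _ * X * _]eq_bigr do rewrite dotC dot_e expr2.
rewrite sumr_const card_ord -/(dot y y).
by case: m {polar} => [|m] /=; rewrite ?exprS; ring.
Qed.

(** The coefficient of t^4, divided by 2. *)
Lemma zonal_polar4 w c :
    (forall y, \sum_k w k * dot (z k) y ^+ 8 = c * dot y y ^+ 4) ->
  forall x y,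
    35%:R * (\sum_k w k * dot (z k) x ^+ 4 * dot (z k) y ^+ 4) =
    c * (3%:R * (dot x x * dot y y) ^+ 2 +
         24%:R * dot x x * dot y y * dot x y ^+ 2 + 8%:R * dot x y ^+ 4).
Proof.
move=> /(@line_identity _ _ 4) zonal x y.
have /(congr1 (coefp 4)) := zonal x y.
rewrite /= coef_sum coefZ coef4_trinomial_exp4 => coef4.
apply: (@mulfI _ 2%:R); first by rewrite pnatr_eq0.
transitivity (c * (6%:R * (dot y y * dot x x) ^+ 2 +
  12%:R * (dot y y * dot x x) * (2%:R * dot x y) ^+ 2 +
  (2%:R * dot x y) ^+ 4)).
  rewrite -coef4 !mulr_sumr; apply: eq_bigr => k _.
  by rewrite coefZ coef4_trinomial_exp4; ring.
by ring.
Qed.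

End Moments.

(** * The reproducing kernel of ternary quartics *)

Section Space.
Variables (F : numFieldType) (s : nat).
Implicit Types (z : 'I_s -> 'I_3 -> F) (x y : 'I_3 -> F).

(** Iterating [zonal_contraction] in dimension 3: the factors
(2 i + 3) / (2 i + 1) for m <= i < m + e telescope. *)
Lemma zonal_moments z e m :
    (forall y, \sum_k dot (z k) y ^+ (2 * (m + e)) = dot y y ^+ (m + e)) ->
  forall y, \sum_k dot (z k) (z k) ^+ e * dot (z k) y ^+ (2 * m) =
            (2 * (m + e) + 1)%:R / (2 * m + 1)%:R * dot y y ^+ m.
Proof.
elim: e m => [|e IHe] m zonal y.
  rewrite addn0 divff ?mul1r ?pnatr_eq0 ?addn1 //.
  rewrite -[in RHS](addn0 m) -zonal addn0.
  by under eq_bigr do rewrite mul1r.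
have := zonal_contraction (IHe m.+1 _); rewrite addSnnS => /(_ zonal y) contr.
apply: (@mulfI _ (2 * m + 1)%:R); first by rewrite pnatr_eq0 addn1.
under eq_bigr do rewrite exprSr.
rewrite contr mulnS.
by field; rewrite -!natrM -!natrD !natr1 !pnatr_eq0.
Qed.

(** One ninth of the sum P_0 + 5 P_2 + 9 P_4 of Legendre polynomials in the
cosine of the angle between x and y, homogenized to bidegree (4, 4). The sum
is the reproducing kernel of quartic forms for the invariant functional of
mass 1 on the sphere; here the mass is 9, the value of [zonal_moments] for
m = 0 and e = 4. *)
Definition zonal_kernel x y : F := 5%:R / 24%:R *
  (21%:R * dot x y ^+ 4 - 14%:R * dot x y ^+ 2 * (dot x x * dot y y) +
   (dot x x * dot y y) ^+ 2).

(** Expanding the product leaves nine moments, each of them known from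
[zonal_moments] or its polarizations. *)
Lemma zonal_kernel_reproducing z :
    (forall y, \sum_k dot (z k) y ^+ 8 = dot y y ^+ 4) ->
  forall x y,
    \sum_k zonal_kernel x (z k) * zonal_kernel (z k) y = zonal_kernel x y.
Proof.
move=> zonal x y.
pose mom e i j :=
  \sum_k dot (z k) (z k) ^+ e * dot (z k) x ^+ i * dot (z k) y ^+ j.
(* Opaque names: otherwise [mulr_sumr] distributes over the sums inside
   [dot x x] and [dot y y]. *)
have [X XE] : exists X, X = dot x x by exists (dot x x).
have [Y YE] : exists Y, Y = dot y y by exists (dot y y).
transitivity ((5%:R / 24%:R) ^+ 2 * (441%:R * mom 0 4 4 +
    - (294%:R * X) * mom 1 2 4 + - (294%:R * Y) * mom 1 4 2 +
    196%:R * (X * Y) * mom 2 2 2 +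
    21%:R * X ^+ 2 * mom 2 0 4 + 21%:R * Y ^+ 2 * mom 2 4 0 +
    - (14%:R * (X ^+ 2 * Y)) * mom 3 0 2 +
    - (14%:R * (X * Y ^+ 2)) * mom 3 2 0 +
    (X * Y) ^+ 2 * mom 4 0 0)).
  rewrite /mom !mulr_sumr -!big_split /= mulr_sumr.
  by apply: eq_bigr => k _; rewrite /zonal_kernel (dotC x (z k)) XE YE; ring.
have M e m : (m + e = 4)%N -> forall u,
    \sum_k dot (z k) (z k) ^+ e * dot (z k) u ^+ (2 * m) =
    9%:R / (2 * m + 1)%:R * dot u u ^+ m.
  by move=> me u; rewrite zonal_moments me.
have mom044 : mom 0 4 4 = (3%:R * (dot x x * dot y y) ^+ 2 +
    24%:R * dot x x * dot y y * dot x y ^+ 2 + 8%:R * dot x y ^+ 4) / 35%:R.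
  apply: (@mulfI _ 35%:R); first by rewrite pnatr_eq0.
  rewrite (@zonal_polar4 _ _ _ z (fun=> 1) 1); first by field.
  by move=> u; rewrite mul1r -zonal; apply: eq_bigr => k _; rewrite mul1r.
have mom1 u v :
    \sum_k dot (z k) (z k) ^+ 1 * dot (z k) u ^+ 2 * dot (z k) v ^+ 4 =
    9%:R / 35%:R * (dot u u * dot v v ^+ 2 + 4%:R * dot u v ^+ 2 * dot v v).
  apply: (@mulfI _ 5%:R); first by rewrite pnatr_eq0.
  by rewrite (zonal_polar2 (M 1 3 erefl) u v) /=; field.
have mom222 : mom 2 2 2 =
    3%:R / 5%:R * (dot x x * dot y y + 2%:R * dot x y ^+ 2).
  apply: (@mulfI _ 3%:R); first by rewrite pnatr_eq0.
  by rewrite (zonal_polar2 (M 2 2 erefl) x y) /=; field.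
have mom142 : mom 1 4 2 =
    9%:R / 35%:R * (dot y y * dot x x ^+ 2 + 4%:R * dot x y ^+ 2 * dot x x).
  by rewrite (dotC x y) -mom1; apply: eq_bigr => k _; rewrite mulrAC.
have mom_x0 e i : mom e i 0 = \sum_k dot (z k) (z k) ^+ e * dot (z k) x ^+ i.
  by apply: eq_bigr => k _; rewrite mulr1.
have mom_0y e j : mom e 0 j = \sum_k dot (z k) (z k) ^+ e * dot (z k) y ^+ j.
  by apply: eq_bigr => k _; rewrite mulr1.
rewrite mom044 /mom mom1 -/(mom 1 4 2) mom142 -/(mom 2 2 2) mom222.
rewrite -/(mom 2 0 4) -/(mom 2 4 0) -/(mom 3 0 2) -/(mom 3 2 0) -/(mom 4 0 0).
rewrite !mom_x0 !mom_0y !(M 2 2 erefl) !(M 3 1 erefl) (M 4 0 erefl).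
by rewrite /zonal_kernel XE YE; field.
Qed.

Lemma zonal_kernel_diag x : zonal_kernel x x = 5%:R / 3%:R * dot x x ^+ 4.
Proof. by rewrite /zonal_kernel; field. Qed.

Definition zonal_gram z := \matrix_(i, j) zonal_kernel (z i) (z j).

Lemma zonal_gram_idem z :
    (forall y, \sum_k dot (z k) y ^+ 8 = dot y y ^+ 4) ->
  zonal_gram z *m zonal_gram z = zonal_gram z.
Proof.
move=> zonal; apply/matrixP=> i j.
rewrite !mxE -(zonal_kernel_reproducing zonal).
by apply: eq_bigr => k _; rewrite !mxE.
Qed.

Lemma zonal_gram_rank z :
    (forall y, \sum_k dot (z k) y ^+ 8 = dot y y ^+ 4) ->
  \rank (zonal_gram z) = 15%N.
Proof.
move=> zonal; have idG := zonal_gram_idem zonal.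
(* The moment with m = 0 does not depend on the vector: any will do. *)
have mom4 := @zonal_moments z 4 0 zonal (fun=> 0).
apply/eqP; rewrite -(eqr_nat F) -(mxtrace_idem idG); apply/eqP.
transitivity (5%:R / 3%:R *
  (\sum_k dot (z k) (z k) ^+ 4 * dot (z k) (fun=> 0) ^+ (2 * 0))).
  rewrite mulr_sumr; apply: eq_bigr => k _.
  by rewrite mxE zonal_kernel_diag mulr1.
by rewrite mom4; field.
Qed.

End Space.

(** * Fifteen points are impossible *)

(** The terms agree up to sign, so the sum is an integer multiple of one of
them. *)
Lemma sum_common_square (R : idomainType) (I : finType) (P : pred I)
    (v : I -> R) a :
    (forall i, P i -> v i ^+ 2 = a) ->
  exists n : nat, (\sum_(i | P i) v i) ^+ 2 = a *+ (n ^ 2).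
Proof.
move=> v2; have [i0 Pi0|P0] := pickP P; last first.
  by exists 0%N; rewrite big_pred0 // expr0n.
have vE i : P i -> exists b : bool, v i = (-1) ^+ b * v i0.
  move=> Pi; have : v i ^+ 2 == v i0 ^+ 2 by rewrite !v2.
  rewrite eqf_sqr => /orP[]/eqP->; first by exists false; rewrite mul1r.
  by exists true; rewrite mulN1r.
have [m ->] : exists m : int, \sum_(i | P i) v i = v i0 *~ m.
  elim/big_ind: _ => [|_ _ [m ->] [m' ->]|i Pi].
  - by exists 0; rewrite mulr0z.
  - by exists (m + m'); rewrite mulrzDr.
  have [b ->] := vE i Pi; exists ((-1) ^+ b).
  by case: b; rewrite ?mulN1r ?mul1r ?mulrN1z.
exists `|m|%N; rewrite -(v2 _ Pi0) -mulrzl exprMn -rmorphXn /= -mulr_natl.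
by rewrite -abszX pmulrn gez0_abs ?sqr_ge0.
Qed.

Lemma seven_not_square n : (n ^ 2 != 7)%N.
Proof.
have [n_ge3|] := leqP 3 n; last by case: n => [|[|[|n]]].
by rewrite eq_sym ltn_eqF // (@leq_trans (3 ^ 2)) ?leq_sqr.
Qed.

Lemma no_tight_decomposition (F : numFieldType) (z : 'I_15 -> 'I_3 -> F) :
  ~ (forall y, \sum_k dot (z k) y ^+ 8 = dot y y ^+ 4).
Proof.
move=> zonal; set G := zonal_gram z.
have unitG : G \in unitmx.
  by rewrite -row_free_unit /row_free (zonal_gram_rank zonal).
have G1 : G = 1%:M.
  by rewrite -[LHS](mulKmx unitG) (zonal_gram_idem zonal) mulVmx.
have kernelE i j : zonal_kernel (z i) (z j) = (i == j)%:R.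
  by move/matrixP/(_ i j): G1; rewrite !mxE.
pose q i := dot (z i) (z i).
have q4 i : q i ^+ 4 = 3%:R / 5%:R.
  apply: (@mulfI _ (5%:R / 3%:R)).
    by rewrite mulf_neq0 ?invr_eq0 ?pnatr_eq0.
  by rewrite -zonal_kernel_diag kernelE eqxx /=; field.
have q_neq0 i : q i != 0.
  apply/eqP => q0; have /eqP := q4 i; rewrite q0 expr0n eq_sym /=.
  by apply/negP; rewrite mulf_neq0 ?invr_eq0 ?pnatr_eq0.
(* 21 u - 7, where 21 u^2 - 14 u + 1 = 0 for the squared cosine u. *)
pose v j := 21%:R * (dot (z j) (z 0) ^+ 2 / (q j * q 0)) - 7%:R.
have v_sqr j : j != 0 -> v j ^+ 2 = 28%:R.
  move=> j_neq0; have := kernelE j 0.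
  rewrite (negPf j_neq0) /zonal_kernel -/(q _) -/(q _) => ker0.
  transitivity (28%:R + 24%:R * 21%:R / 5%:R / (q j * q 0) ^+ 2 *
    (5%:R / 24%:R * (21%:R * dot (z j) (z 0) ^+ 4 -
      14%:R * dot (z j) (z 0) ^+ 2 * (q j * q 0) + (q j * q 0) ^+ 2))).
    by rewrite /v; field; rewrite !q_neq0.
  by rewrite ker0 mulr0 addr0.
(* The degree 2 moment at z 0, divided through by q (z 0): as q^4 is constant,
   its weights q^3 are proportional to 1 / q. *)
have sum_v : \sum_j v j = 0.
  rewrite sumrB sumr_const card_ord -mulr_sumr.
  have mom1 := @zonal_moments _ _ z 3 1 zonal (z 0).
  suff -> : \sum_j dot (z j) (z 0) ^+ 2 / (q j * q 0) = 5%:R by ring.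
  transitivity (5%:R / 3%:R / q 0 *
     (\sum_j q j ^+ 3 * dot (z j) (z 0) ^+ (2 * 1))).
    rewrite mulr_sumr; apply: eq_bigr => j _.
    have -> : q j ^+ 3 = 3%:R / 5%:R / q j.
      by rewrite -(q4 j); field; rewrite q_neq0.
    by field; rewrite !q_neq0.
  by rewrite mom1 -/(q 0); field; rewrite q_neq0.
have v0 : v 0 = 14%:R.
  by rewrite /v -/(q 0) -expr2 divff ?expf_neq0 //; ring.
have [n] := sum_common_square v_sqr.
have -> : \sum_(j | j != 0) v j = - 14%:R.
  move: sum_v; rewrite (bigD1 0) //= v0 addrC => /eqP.
  by rewrite addr_eq0 => /eqP.
have -> : (- 14%:R) ^+ 2 = 28%:R *+ 7 :> F by ring.
rewrite -!mulrnA => /eqP; rewrite eqr_nat eqn_pmul2l // => /eqP n2.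
by have := seven_not_square n; rewrite -n2 eqxx.
Qed.

Lemma zonal_size_gt15 (F : numFieldType) s (z : 'I_s -> 'I_3 -> F) :
  (forall y, \sum_k dot (z k) y ^+ 8 = dot y y ^+ 4) -> (15 < s)%N.
Proof.
move=> zonal; rewrite ltn_neqAle.
rewrite -[X in (_ && (X <= _))%N](zonal_gram_rank zonal) rank_leq_row andbT.
by apply/eqP => s15; case: _ / s15 z zonal => z /no_tight_decomposition.
Qed.

(** * Sixteen powers from the icosahedron *)

(** With phi the golden ratio: the directions of the axes through opposite
vertices of the regular icosahedron with vertices (+-1, +-phi, 0) and their
cyclic shifts. *)
Definition icosahedron_axes (A : pzRingType) (phi x y z : A) : seq A :=
  [:: x + phi * y; x - phi * y; y + phi * z; y - phi * z;
      z + phi * x; z - phi * x].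

(** The axes through opposite face centres of that icosahedron, when
psi = 1 / phi. Exchanging phi and psi here gives a dodecahedron that is not in
dual position, for which [icosahedral_identity] fails. *)
Definition dodecahedron_axes (A : pzRingType) (phi psi x y z : A) : seq A :=
  [:: x + y + z; x + y - z; x - y + z; x - y - z;
      phi * x + psi * y; phi * x - psi * y; phi * y + psi * z;
      phi * y - psi * z; phi * z + psi * x; phi * z - psi * x].

(** The relation phi^2 = phi + 1 makes phi - 1 the inverse of phi. The weight
3 psi^4 is the one for which the coefficients of x^8 and of x^6 y^2 are in the
ratio 1 : 4 that they have in the fourth power of the sum of squares. *)
Lemma icosahedral_identity (A : comPzRingType) (phi psi x y z : A) :
    phi ^+ 2 = phi + 1 -> psi = phi - 1 ->
  \sum_(p <- dodecahedron_axes phi psi x y z) p ^+ 8 +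
    3%:R * psi ^+ 4 * (\sum_(p <- icosahedron_axes phi x y z) p ^+ 8) =
  140%:R * (x ^+ 2 + y ^+ 2 + z ^+ 2) ^+ 4.
Proof.
move=> phi2 ->; rewrite /dodecahedron_axes /icosahedron_axes.
by rewrite !big_cons !big_nil; ring: phi2.
Qed.

Lemma quartic_power_decomposition (F : numClosedFieldType) :
  exists l : 'I_16 -> {mpoly F[3]},
    waring_decomposition 8 (sum_of_squares F 3 ^+ 4) l.
Proof.
have [phi phi2] : exists phi : F, phi ^+ 2 = phi + 1.
  exists ((1 + sqrtC 5%:R) / 2%:R).
  by rewrite expr_div_n sqrrD sqrtCK; field.
pose psi := phi - 1.
pose a := 8.-root (140%:R^-1 : F); pose b := 8.-root (3%:R * psi ^+ 4 / 140%:R).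
have a8 : a ^+ 8 = 140%:R^-1 by rewrite rootCK.
have b8 : b ^+ 8 = 3%:R * psi ^+ 4 / 140%:R by rewrite rootCK.
pose x : {mpoly F[3]} := 'X_ord0.
pose y : {mpoly F[3]} := 'X_(lift ord0 ord0).
pose z : {mpoly F[3]} := 'X_(lift ord0 (lift ord0 ord0)).
pose dod := dodecahedron_axes phi%:MP psi%:MP x y z.
pose ico := icosahedron_axes phi%:MP x y z.
pose forms := [seq a *: p | p <- dod] ++ [seq b *: p | p <- ico].
exists (fun j => nth 0 forms j); split=> [j|].
  have /allP : all (fun p => p \is 1.-homog) forms.
    have X i : ('X_i : {mpoly F[3]}) \is 1.-homog by rewrite dhomogX /= mdeg1.
    by rewrite /= !mul_mpolyC !(rpredZ, rpredD, rpredN, X).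
  by apply; rewrite mem_nth.
have -> : \sum_(j < 16) nth 0 forms j ^+ 8 = \sum_(p <- forms) p ^+ 8.
  by rewrite [RHS](big_nth 0) big_mkord.
rewrite big_cat !big_map /=.
under eq_bigr do rewrite exprZn.
under [X in _ + X]eq_bigr do rewrite exprZn.
rewrite -!scaler_sumr a8 b8.
have -> : sum_of_squares F 3 = x ^+ 2 + y ^+ 2 + z ^+ 2.
  by rewrite /sum_of_squares !big_ord_recl big_ord0 addr0 addrA.
have nz140 : 140%:R != 0 :> F by rewrite pnatr_eq0.
apply: (scalerI nz140); rewrite scalerDr !scalerA mulfV // mulrCA mulfV //.
rewrite scale1r mulr1.
have := @icosahedral_identity _ phi%:MP psi%:MP x y z.
rewrite -!mul_mpolyC mpolyCM !mpolyC_nat rmorphXn => <- //.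
  by rewrite -rmorphXn phi2 rmorphD rmorph1.
by rewrite rmorphB rmorph1.
Qed.

(** * The Waring rank *)

Lemma linear_form_eval (F : comNzRingType) n (p : {mpoly F[n]})
    (y : 'I_n -> F) :
  p \is 1.-homog -> p.@[y] = dot (fun i => p@_U_(i)) y.
Proof.
move=> homog_p; have {1}-> : p = \sum_i p@_U_(i) *: 'X_i.
  apply/mpolyP=> m; rewrite raddf_sum /=.
  under eq_bigr do rewrite mcoeffZ mcoeffX.
  have [/mdeg1P[i /eqP->]|m_neq1] := boolP (mdeg m == 1%N); last first.
    rewrite (dhomog_nemf_coeff homog_p) // big1 // => i _.
    by case: (U_(i)%MM =P m) m_neq1 => [<-|_ _]; rewrite ?mdeg1 ?mulr0.
  rewrite (bigD1 i) //= eqxx mulr1 big1 ?addr0 // => j j_neqi.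
  by rewrite eq_mnm1 (negPf j_neqi) mulr0.
rewrite raddf_sum; apply: eq_bigr => i _.
by rewrite /= mevalZ mevalXU.
Qed.

Lemma sum_of_squares_eval (F : comNzRingType) n (y : 'I_n -> F) :
  (sum_of_squares F n).@[y] = dot y y.
Proof.
rewrite raddf_sum; apply: eq_bigr => i _.
by rewrite /= rmorphXn /= mevalXU expr2.
Qed.

(* R[i] with R : realType is the field of complex numbers. *)
Theorem corollary5p43 (R : realType) :
  is_waring_rank 8 (sum_of_squares R[i] 3 ^+ 4) 16.
Proof.
split=> [|s l [homog_l q4E]]; first exact: quartic_power_decomposition.
apply: (@zonal_size_gt15 _ s (fun k i => (l k)@_U_(i))) => y.
rewrite -sum_of_squares_eval -rmorphXn /= q4E raddf_sum; apply: eq_bigr => k _.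
by rewrite /= rmorphXn /= linear_form_eval.
Qed.
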